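(* Let $Q>0$ and assume that $X=(X,d,\mu)$ is an Ahlfors $Q$-regular metric space. Let $\emptyset\neq E\subset X$ be a closed set with $\dim_A(E)<Q$, where $\dim_A(E)$ denotes the (upper) Assouad dimension of $E$, and let $\alpha\in\mathbb{R}$ and $w=\delta_E^{-\alpha}$, where $\delta_E(x)=\operatorname{dist}(x,E)$. Then (A) for $1<p<\infty$: $w\in A_p$ if and only if $(1-p)(Q-\dim_A(E))<\alpha<Q-\dim_A(E)$; (B) $w\in A_1$ if and only if $0\le\alpha<Q-\dim_A(E)$.
   Context: $X=(X,d,\mu)$ is a metric space with at least two points, equipped with a Borel measure $\mu$ supported on $X$ such that $0<\mu(B)<\infty$ for every open ball $B=B(x,r)=\{y\in X: d(x,y)<r\}$, $x\in X$, $r>0$. The measure $\mu$ is doubling: there is $C_D>0$ with $\mu(B(x,2r))\le C_D\,\mu(B(x,r))$ for all $x\in X$, $r>0$. $X$ is (Ahlfors) $Q$-regular if there is $C\ge1$ such that $C^{-1}r^Q\le\mu(B(x,r))\le Cr^Q$ for all $x\in X$ and all $0<r<\operatorname{diam}(X)$. The (upper) Assouad dimension $\dim_A(E)$ of $E\subset X$ is the infimum of the exponents $s\ge0$ for which there is a constant $C\ge1$ such that for all $x\in E$ and all $0<r<R<2\operatorname{diam}(X)$ the set $E\cap B(x,R)$ can be covered by at most $C(r/R)^{-s}$ balls of radius $r$. A weight is a measurable function $w$ on $X$ such that $w(x)>0$ for $\mu$-almost every $x\in X$ and $\int_B w\,d\mu<\infty$ for every ball $B\subset X$. For $1<p<\infty$,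 a weight $w$ belongs to the Muckenhoupt class $A_p$ if there is a constant $A>0$ such that for every ball $B$ in $X$ $$\Bigl(\frac1{\mu(B)}\int_B w\,d\mu\Bigr)\Bigl(\frac1{\mu(B)}\int_B w^{-1/(p-1)}\,d\mu\Bigr)^{p-1}\le A.$$ A weight $w$ belongs to $A_1$ if there is $A>0$ such that for every ball $B$ in $X$ $$\Bigl(\frac1{\mu(B)}\int_B w\,d\mu\Bigr)\operatorname*{ess\,sup}_{y\in B}\frac1{w(y)}\le A.$$ Convention: $\delta_E^{-\alpha}=+\infty$ on $E$ if $\alpha>0$, and $\delta_E^0=1$. *)

(* Defs.v *)
From HB Require Import structures.
From mathcomp Require Import all_boot all_order all_algebra.
From mathcomp Require Import all_classical all_reals all_analysis.
From mathcomp Require Import measurable_realfun ess_sup_inf.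

Set Implicit Arguments.
Unset Strict Implicit.
Unset Printing Implicit Defensive.

Import Order.TTheory GRing.Theory Num.Theory.
Import numFieldNormedType.Exports.

Local Open Scope classical_set_scope.
Local Open Scope ring_scope.

HB.mixin Record Metric_isBorel (d : measure_display) (R : numDomainType) X
    & Measurable d X & Metric R X := {
  borel_measurableE : @measurable d X = <<s @open X >> }.

#[short(type="borelMetricType")]
HB.structure Definition BorelMetric (d : measure_display) (R : numDomainType) :=
  { X of Measurable d X & Metric R X & Metric_isBorel d R X }.

Section metric.
Context {R : realType} {X : metricType R}.
Implicit Types (E : set X) (x y : X).

Definition diam E : \bar R :=
  ereal_sup [set (mdist x y)%:E | x in E & y in E].

(* Only meaningful for nonempty E: the real-valued infimum of set0 is 0. *)
Definition dist_set E x : R := inf [set mdist x y | y in E].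

Definition assouad_exponent E (s : R) : Prop :=
  exists2 C : R, 1 <= C &
    forall x (r rho : R), E x -> 0 < r -> r < rho ->
      (rho%:E < 2%:E * diam [set: X])%E ->
      exists c : seq X,
        (size c)%:R <= C * (r / rho) `^ (- s) /\
        E `&` ball x rho `<=` \bigcup_(y in [set` c]) ball y r.

Definition assouad_dim E : \bar R :=
  ereal_inf [set s%:E | s in [set s : R | 0 <= s /\ assouad_exponent E s]].

End metric.

(* The library's x `^ s sends 0 to 0 and +oo to +oo also for s < 0; the usual
   conventions 0 ^ s = +oo and +oo ^ s = 0 for s < 0 need an extended inverse. *)
Definition epow {R : realType} (x : \bar R) (s : R) : \bar R :=
  (if (s < 0)%R then (x `^ (- s))^-1 else x `^ s)%E.

Definition dist_weight {R : realType} {X : metricType R} (E : set X) (alpha : R)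
    (x : X) : \bar R :=
  epow (dist_set E x)%:E (- alpha).

Section measure.
Context {d : measure_display} {R : realType} {X : borelMetricType d R}.
Variable mu : {measure set X -> \bar R}.
Implicit Types (w f : X -> \bar R) (B : set X) (x y : X) (r : R).

Definition doubling : Prop :=
  exists2 C : R, 0 < C &
    forall x r, 0 < r -> (mu (ball x (2 * r)) <= C%:E * mu (ball x r))%E.

Definition ahlfors_regular (Q : R) : Prop :=
  exists2 C : R, 1 <= C &
    forall x r, 0 < r -> (r%:E < diam [set: X])%E ->
      ((C^-1 * r `^ Q)%:E <= mu (ball x r) <= (C * r `^ Q)%:E)%E.

Definition weight w : Prop :=
  [/\ measurable_fun [set: X] w,
      {ae mu, forall x, (0 < w x)%E} &
      forall x r, 0 < r -> (\int[mu]_(y in ball x r) w y < +oo)%E].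

Definition average B f : \bar R := ((mu B)^-1 * \int[mu]_(y in B) f y)%E.

(* The library's ess_sup, relative to a subset B of X. *)
Definition ess_sup_on B f : \bar R :=
  ereal_inf [set M | {ae mu, forall y, B y -> (f y <= M)%E}].

Definition muckenhoupt (p : R) w : Prop :=
  weight w /\
  exists2 A : R, 0 < A &
    forall x r, 0 < r ->
      (average (ball x r) w *
       average (ball x r) (fun y => epow (w y) (- (1 / (p - 1)))) `^ (p - 1)
       <= A%:E)%E.

Definition muckenhoupt1 w : Prop :=
  weight w /\
  exists2 A : R, 0 < A &
    forall x r, 0 < r ->
      (average (ball x r) w * ess_sup_on (ball x r) (fun y => (w y)^-1)
       <= A%:E)%E.

End measure.

(* Main.v *)
Require Import Defs.
From HB Require Import structures.
From mathcomp Require Import all_boot all_order all_algebra.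
From mathcomp Require Import all_classical all_reals all_analysis.
From mathcomp Require Import measurable_realfun ess_sup_inf.
From mathcomp Require Import ring lra.

Import Order.TTheory GRing.Theory Num.Theory.
Import numFieldNormedType.Exports.

Local Open Scope classical_set_scope.
Local Open Scope ring_scope.

(** Write delta for the distance to E, and let s run through the exponents
above the Assouad dimension D of E.  A ball of radius r meets E in a set covered
by about (r/t)^s balls of radius t, so by regularity the points of that ball
with delta < t fill at most a share (t/r)^(Q-s) of it ([neighborhood_measure]).
Both halves of the equivalences follow from this decay.

Sufficiency.  Near E, summing the decay over the dyadic layers of delta bounds
the integral of delta^g over a ball of radius r by C r^(Q+g), provided that
g > -(Q-D) ([near_integral]); away from E, delta is almost constant on the
ball.  Hence the mean of delta^g over B(x,r) is at most C max(r, delta x)^g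
([average_epow_le]).  In the Muckenhoupt product this applies to delta^(-alpha)
and to its dual power delta^(alpha/(p-1)), one condition on alpha for each, and
the powers of max(r, delta x) cancel.  For A_1 the second factor is the
supremum of delta^alpha.

Necessity.  The decay at t = c r shows that delta >= c r on a fixed share of
every ball ([porosity]), so the factor with the nonnegative power of delta has
the size it should have, and the Muckenhoupt condition becomes an upper bound
C r^(-b) for the mean of delta^(-b) over the balls centred on E, where
b = alpha > 0, or b = -alpha/(p-1) if alpha < 0.  (In A_1 the second case cannot
occur, since 1/w is unbounded near E.)  By itself the bound gives D <= Q - b;
the strict inequality needs self-improvement.  At the scale l^k r a maximal
packing of E in a ball of radius r, with N_k points, contributes at least a
constant times N_k l^(k(Q-b)) to the normalised integral of delta^(-b), and for
l small the contributions of different k come from disjoint layers of delta.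
Their sum is bounded, so one of the first K scales, K a constant, has
N_k <= l^(-k(Q-b)) / 2 ([exists_sparse_scale]).  The factor 1/2 is worth a
power l^(k eps) with a uniform eps > 0, and iterating these sparse covers
produces covers with the exponent Q - b - eps ([assouad_dim_lt_of_growth]). *)

(** * Powers and geometric sums *)

Section power.
Context {R : realType}.
Implicit Types a b g h : R.

Lemma powRDg a g h : 0 < a -> a `^ (g + h) = a `^ g * a `^ h.
Proof. by move=> a0; rewrite powRD// (gt_eqF a0) implybT. Qed.

Lemma powRMg a b g : 0 < a -> 0 < b -> (a * b) `^ g = a `^ g * b `^ g.
Proof. by move=> a0 b0; rewrite powRM// ltW. Qed.

Lemma powRKr a g : 0 < a -> g != 0 -> (a `^ g^-1) `^ g = a.
Proof. by move=> a0 g0; rewrite -powRrM mulVf// powRr1// ltW. Qed.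

Lemma ler_powR_neg a b g : g <= 0 -> 0 < a -> a <= b -> b `^ g <= a `^ g.
Proof.
move=> g0 a0 ab; have b0 := lt_le_trans a0 ab.
rewrite -(opprK g) !(powRN _ (- g)) lef_pV2 ?posrE ?powR_gt0//.
by apply: ge0_ler_powR; rewrite ?oppr_ge0 ?nnegrE ?(ltW a0) ?(ltW b0).
Qed.

Lemma exists_powR_le a b : 0 < a -> 0 < b -> exists2 q, 0 < q < 1 & q `^ a <= b.
Proof.
move=> a0 b0; exists (Num.min 2^-1 (b `^ a^-1)).
  by rewrite lt_min gt_min powR_gt0// invr_gt0 invf_lt1// ltr1n ltr0n.
apply: le_trans (_ : (b `^ a^-1) `^ a <= _); last by rewrite powRKr// gt_eqF.
by apply: ge0_ler_powR; rewrite ?nnegrE ?powR_ge0 ?(ltW a0)// ?ge_min ?lexx ?orbT//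
  le_min powR_ge0 invr_ge0 ler0n.
Qed.

Lemma exists_exprn_le a b : 0 < a < 1 -> 0 < b -> exists n, a ^+ n <= b.
Proof.
move=> /andP[a0 a1] b0; have na1 : `|a| < 1 by rewrite ger0_norm// ltW.
have [n _ /(_ n (leqnn n))] := cvgr0_norm_lt _ (cvg_expr na1) _ b0.
by move=> /= /ltW ab; exists n; rewrite (le_trans (ler_norm _)).
Qed.

Lemma exists_powR_ge_half a : 0 < a < 1 -> exists2 eps, 0 < eps & 2^-1 <= a `^ eps.
Proof.
move=> /andP[a0 a1]; have lna : ln a < 0 by rewrite ln_lt0// a0.
have ln2 : ln (2^-1 : R) < 0.
  by rewrite ln_lt0// invr_gt0 ltr0n invf_lt1// ltr1n.
exists (ln 2^-1 / ln a); first by rewrite nmulr_rgt0 ?invr_lt0.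
by rewrite /powR gt_eqF// divfK ?lt_eqF// lnK// posrE invr_gt0.
Qed.

Lemma powRX a g n : 0 <= a -> (a ^+ n) `^ g = (a `^ g) ^+ n.
Proof.
by move=> a0; rewrite -(powR_mulrn n a0) powRAC powR_mulrn// powR_ge0.
Qed.

Lemma nneseries_geometric_le a q : 0 <= a -> 0 < q < 1 ->
  (\sum_(0 <= k <oo) (a * q ^+ k)%:E <= (a / (1 - q))%:E)%E.
Proof.
move=> a0 /andP[q0 q1]; have aq k : 0 <= a * q ^+ k.
  by rewrite mulr_ge0// exprn_ge0// ltW.
apply: lime_le.
  by apply: is_cvg_nneseries => k _ _; rewrite lee_fin.
apply: nearW => n; rewrite sumEFin lee_fin.
have := @geometric_seriesE R a q (negbT (lt_eqF q1)).
move=> /(congr1 (fun u => u n)); rewrite /series /geometric /= => ->.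
rewrite ler_pM2r ?invr_gt0 ?subr_gt0//.
by rewrite mulrBr mulr1 gerBl aq.
Qed.

Lemma epow_ge0 (x : \bar R) g : (0 <= epow x g)%E.
Proof. by rewrite /epow; case: ifP => _; rewrite ?inve_ge0 poweR_ge0. Qed.

Lemma epowE a g : 0 < a -> epow a%:E g = (a `^ g)%:E.
Proof.
move=> a0; rewrite /epow; case: ifP => // g0.
by rewrite poweR_EFin inver gt_eqF ?powR_gt0// powRN invrK.
Qed.

Lemma epow0_lt0 g : g < 0 -> epow (0 : R)%:E g = +oo%E.
Proof. by move=> g0; rewrite /epow g0 poweR0r ?inve0// oppr_eq0 lt_eqF. Qed.

Lemma epow_ge0E a g : 0 <= g -> epow a%:E g = (a `^ g)%:E.
Proof. by rewrite /epow leNgt => /negbTE ->. Qed.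

Lemma epow_le a b g : 0 <= g -> 0 <= a -> a <= b ->
  (epow a%:E g <= (b `^ g)%:E)%E.
Proof.
move=> g0 a0 ab; rewrite epow_ge0E// lee_fin.
by apply: ge0_ler_powR => //; rewrite nnegrE// (le_trans a0).
Qed.

Lemma epow_ge a b g : 0 <= g -> 0 <= b -> b <= a ->
  ((b `^ g)%:E <= epow a%:E g)%E.
Proof.
move=> g0 b0 ba; rewrite epow_ge0E// lee_fin.
by apply: ge0_ler_powR => //; rewrite nnegrE// (le_trans b0).
Qed.

Lemma epow_le_neg a b g : g <= 0 -> 0 < b -> b <= a ->
  (epow a%:E g <= (b `^ g)%:E)%E.
Proof.
by move=> g0 b0 ba; rewrite epowE ?(lt_le_trans b0)// lee_fin ler_powR_neg.
Qed.

Lemma epow_ge_neg a b g : g < 0 -> 0 <= a -> a <= b ->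
  ((b `^ g)%:E <= epow a%:E g)%E.
Proof.
move=> g0; rewrite le_eqVlt => /orP[/eqP <- _|a0 ab].
  by rewrite epow0_lt0// leey.
by rewrite epowE// lee_fin ler_powR_neg// ltW.
Qed.

(** At the base point 0 this uses that the inverse exchanges 0 and +oo. *)
Lemma inve_epow a g : 0 <= a -> ((epow a%:E g)^-1 = epow a%:E (- g))%E.
Proof.
rewrite le_eqVlt => /orP[/eqP <-|a0]; last first.
  by rewrite !epowE// inver gt_eqF ?powR_gt0// powRN.
have [g0|g0|->] := ltgtP g 0.
- by rewrite epow0_lt0// invey epow_ge0E ?oppr_ge0 ?ltW// powR0// oppr_eq0 lt_eqF.
- rewrite [RHS]epow0_lt0 ?oppr_lt0// (epow_ge0E _ _ (ltW g0)).
  by rewrite powR0 ?gt_eqF// inve0.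
- by rewrite oppr0 epow_ge0E// powRr0 inve1.
Qed.

(** The conventions for epow make powers compose even at the base point 0: if
g < 0 then 0^g = +oo, whose h-th power 0 is again 0^(g h).  This identifies the
dual weight w^(-1/(p-1)) everywhere, not only off E. *)
Lemma epow_epow a g h : 0 <= a -> h < 0 ->
  epow (epow a%:E g) h = epow a%:E (g * h).
Proof.
rewrite le_eqVlt => /orP[/eqP <-|a0] h0; last first.
  by rewrite !epowE ?powR_gt0// powRrM.
have [g0|g0|->] := ltgtP g 0.
- rewrite epow0_lt0// /epow h0 poweRyr ?oppr_eq0 ?lt_eqF//.
  have gh : 0 < g * h by rewrite nmulr_rgt0.
  by rewrite invey ltNge ltW//= powR0// gt_eqF.
- rewrite [X in epow X]epow_ge0E ?ltW// powR0 ?gt_eqF// epow0_lt0//.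
  by rewrite epow0_lt0// pmulr_rlt0.
- by rewrite mul0r [epow 0%:E 0]epow_ge0E// powRr0 epowE// powR1.
Qed.

End power.

(** * Balls, distance functions and packings *)

Section metric_geometry.
Context {R : realType} {X : metricType R}.
Implicit Types (x y z e : X) (r t : R) (E F : set X).

Lemma ballP x r y : ball x r y <-> mdist x y < r.
Proof. by rewrite ballEmdist. Qed.

Lemma ball_sub x y r t : mdist x y + t <= r -> ball y t `<=` ball x r.
Proof.
move=> h z /ballP yz; apply/ballP/(le_lt_trans (metric_triangle x y z)).
by apply: lt_le_trans h; rewrite ltrD2l.
Qed.

Lemma ball_open_metric x r : open (ball x r).
Proof.
rewrite openE => y /ballP xy; apply/nbhs_ballP.
exists (r - mdist x y); first by rewrite /= subr_gt0.
by apply: ball_sub; rewrite addrC subrK.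
Qed.

Lemma mdist_le_diam x y : ((mdist x y)%:E <= diam [set: X])%E.
Proof. by apply: ereal_sup_ubound; exists x => //; exists y. Qed.

Lemma diam_gt0 : (exists x y : X, x <> y) -> (0 < diam [set: X])%E.
Proof.
move=> [x [y xy]]; apply: lt_le_trans (mdist_le_diam x y).
by rewrite lte_fin mdist_gt0; apply/eqP.
Qed.

(** In a bounded space a ball of large radius is the whole space, hence equal to
a ball whose radius is in the range where regularity says something. *)
Lemma ball_radius_lt_diam x r : (exists x y : X, x <> y) -> 0 < r ->
  exists2 r', 0 < r' <= r &
    (r'%:E < 2%:E * diam [set: X])%E /\ ball x r = ball x r'.
Proof.
move=> /diam_gt0 D0 r0; have [rD|] := ltP r%:E (2%:E * diam [set: X])%E.
  by exists r; rewrite ?r0/=.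
have dist_diam := mdist_le_diam x.
case: (diam _) D0 dist_diam => [D| |]//; last first.
  by move=> _ _; rewrite gt0_muley ?lte_fin// leye_eq.
rewrite lte_fin => D0 dist_diam; rewrite -EFinM lee_fin => Dr.
(* any radius strictly between the diameter D and 2 D would do *)
exists (D * (3 / 2)); first by apply/andP; split; lra.
split; first by rewrite lte_fin; lra.
by apply/seteqP; split => y _; apply/ballP; have := dist_diam y;
  rewrite lee_fin => xy; lra.
Qed.

Section distance.
Context (E : set X) (E_neq0 : E !=set0).

Lemma dist_set_lbound x : has_lbound [set mdist x y | y in E].
Proof. by exists 0 => _ [y _ <-]; exact: mdist_ge0. Qed.

Lemma dist_set_has_inf x : has_inf [set mdist x y | y in E].
Proof.
split; last exact: dist_set_lbound.
by case: E_neq0 => e Ee; exists (mdist x e); exists e.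
Qed.

Lemma dist_set_ge0 x : 0 <= dist_set E x.
Proof.
apply: lb_le_inf; first by case: (dist_set_has_inf x).
by move=> _ [y _ <-]; exact: mdist_ge0.
Qed.

Lemma dist_set_le x e : E e -> dist_set E x <= mdist x e.
Proof. by move=> Ee; apply: ge_inf; [exact: dist_set_lbound|exists e]. Qed.

Lemma dist_set_in e : E e -> dist_set E e = 0.
Proof.
move=> Ee; apply/eqP; rewrite eq_le dist_set_ge0 andbT.
by rewrite -(mdistxx e) dist_set_le.
Qed.

Lemma dist_set_lt x t : dist_set E x < t -> exists2 e, E e & mdist x e < t.
Proof. by move=> /(inf_lt (dist_set_has_inf x).1)[_ [e Ee <-]]; exists e. Qed.

Lemma dist_set_lip x y : dist_set E x <= dist_set E y + mdist x y.
Proof.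
rewrite -lerBlDr; apply: lb_le_inf; first by case: (dist_set_has_inf y).
move=> _ [e Ee <-]; rewrite lerBlDr addrC.
by apply: le_trans (metric_triangle x y e); exact: dist_set_le.
Qed.

Lemma dist_set_ball x y r : ball x r y ->
  dist_set E y < dist_set E x + r /\ dist_set E x < dist_set E y + r.
Proof.
move=> /ballP xy; split.
  by rewrite (le_lt_trans (dist_set_lip y x))// ltrD2l metric_sym.
by rewrite (le_lt_trans (dist_set_lip x y))// ltrD2l.
Qed.

Lemma dist_set_eq0 x : closed E -> dist_set E x <= 0 -> E x.
Proof.
move=> cE dx; apply: cE => B /nbhs_ballP[r /= r0 rB].
have [e Ee xe] := dist_set_lt x r (le_lt_trans dx r0).
by exists e; split => //; apply/rB/ballP.
Qed.

Lemma dist_set_open t : open [set x | dist_set E x < t].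
Proof.
rewrite openE => x /= xt; apply/nbhs_ballP.
exists (t - dist_set E x); first by rewrite /= subr_gt0.
by move=> y /dist_set_ball[]; rewrite addrC subrK.
Qed.

End distance.

Definition packing F t (c : seq X) :=
  [/\ uniq c, forall y, y \in c -> F y &
      {in c &, forall y z, mdist y z < t -> y = z}].

(** A packing of maximal cardinality covers at its own scale, since a point left
out could be added to it. *)
Lemma exists_packing_cover F t (n : nat) : 0 < t ->
  (forall c, packing F t c -> (size c <= n)%N) ->
  exists2 c, packing F t c & F `<=` \bigcup_(y in [set` c]) ball y t.
Proof.
move=> t0 bounded; pose P k := `[< exists2 c, packing F t c & size c = k >].
have P0 : exists k, P k by exists 0%N; apply/asboolP; exists [::].
have Pn k : P k -> (k <= n)%N by move=> /asboolP[c pc <-]; exact: bounded.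
case: (ex_maxnP P0 Pn) => m /asboolP[c [cu cF cinj] <-] cmax; exists c => //.
move=> z Fz; apply: contrapT => zc.
have far y : y \in c -> mdist y z < t -> False.
  by move=> yc yz; apply: zc; exists y => //; exact/ballP.
suff /cmax : P (size (z :: c)) by rewrite ltnn.
apply/asboolP; exists (z :: c) => //; split=> [|y|y x].
- rewrite /= cu andbT; apply/negP => z_c.
  by apply: (far z) => //; rewrite mdistxx.
- by rewrite inE => /orP[/eqP ->//|/cF].
- rewrite !inE => /orP[/eqP ->|yc] /orP[/eqP ->|xc]//.
  + by rewrite metric_sym => /far-/(_ xc).
  + by move=> /far-/(_ yc).
  + exact: cinj.
Qed.

End metric_geometry.

(** * Measurability *)

Section measurability.
Context {d : measure_display} {R : realType} {X : borelMetricType d R}.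
Implicit Types (x y : X) (r t g : R) (A D : set X).

Lemma open_borel A : open A -> measurable A.
Proof. by move=> oA; rewrite borel_measurableE; exact: sub_sigma_algebra. Qed.

Lemma measurable_ball_metric x r : measurable (ball x r).
Proof. exact/open_borel/ball_open_metric. Qed.

Context (E : set X) (E_neq0 : E !=set0).

Lemma measurable_dist_lt t : measurable [set x | dist_set E x < t].
Proof. exact/open_borel/dist_set_open. Qed.

Lemma measurable_dist_ge t : measurable [set x | t <= dist_set E x].
Proof.
rewrite (_ : [set x | _] = ~` [set x | dist_set E x < t]).
  exact/measurableC/measurable_dist_lt.
by apply/seteqP; split => x /=; rewrite leNgt => /negP.
Qed.

Lemma measurable_dist_set : measurable_fun [set: X] (dist_set E).
Proof.
apply: (measurability _ (RGenOInfty.measurableE R)).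
move=> _ [_ [t ->] <-]; rewrite setTI.
rewrite (_ : _ @^-1` _ = \bigcup_n [set x | t + n.+1%:R^-1 <= dist_set E x]).
  by apply: bigcupT_measurable => n; exact: measurable_dist_ge.
apply/seteqP; split=> x /=; rewrite in_itv/= andbT.
  by move=> /ltr_add_invr[n tn]; exists n => //=; exact: ltW.
by move=> [n _ /=]; apply: lt_le_trans; rewrite ltrDl invr_gt0.
Qed.

Lemma measurable_epow_dist g D :
  measurable_fun D (fun x => epow (dist_set E x)%:E g).
Proof.
apply: (@measurable_funTS _ _ _ _ D); have mdist := measurable_dist_set.
have mpow : measurable_fun [set: X] (fun x => (dist_set E x `^ g)%:E).
  apply/measurable_EFinP.
  exact: (@measurableT_comp _ _ _ _ _ _ (@powR R ^~ g)).
have [g0|g0] := leP 0 g.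
  by under eq_fun do rewrite epow_ge0E//.
rewrite (_ : (fun x => _) =
    fun x => if dist_set E x == 0 then +oo%E else (dist_set E x `^ g)%:E).
  apply: measurable_fun_ifT => //=.
  by apply: measurable_fun_eqr.
apply/funext => x; case: eqP => [->|/eqP x0]; first exact: epow0_lt0.
by rewrite epowE// lt_neqAle eq_sym x0 dist_set_ge0.
Qed.

End measurability.

(** * Counting disjoint sets *)

Section superadditive.
Context {d : measure_display} {R : realType} {X : measurableType d}.
Context (phi : set X -> \bar R).
Context (phi_ge0 : forall D, (0 <= phi D)%E).
Context (phi_superadditive : forall A D, measurable A -> measurable D ->
  A `<=` D -> (phi A + phi (D `\` A) <= phi D)%E).

(** Stated for a superadditive set function so as to serve both for the measure,
where the sets are small balls around the points of a packing, and for the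
integral of a weight, where they are layers of the distance function. *)
Lemma superadditive_count (I : eqType) (s : seq I) (S : I -> set X) D (m : R) :
  uniq s -> measurable D ->
  (forall i, i \in s -> measurable (S i) /\ S i `<=` D) ->
  (forall i j, i \in s -> j \in s -> S i `&` S j !=set0 -> i = j) ->
  (forall i, i \in s -> (m%:E <= phi (S i))%E) ->
  (((size s)%:R * m)%:E <= phi D)%E.
Proof.
elim: s D => [|i s IH] D; first by rewrite mul0r.
move=> /= /andP[si us] mD SD disj mS.
have [mSi SiD] := SD i (mem_head _ _).
apply: le_trans (phi_superadditive _ _ mSi mD SiD).
rewrite -natr1 mulrDl mul1r addrC EFinD leeD//; first exact/mS/mem_head.
apply: IH => //; first exact: measurableD.
- move=> j js; have js' : j \in i :: s by rewrite inE js orbT.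
  have [mSj SjD] := SD j js'; split=> // x Sjx; split; first exact: SjD.
  move=> Six; move: si; rewrite (_ : i = j) ?js//.
  by apply: disj => //; [exact: mem_head|exists x].
- by move=> j k js ks; apply: disj; rewrite inE ?js ?ks orbT.
- by move=> j js; apply: mS; rewrite inE js orbT.
Qed.

End superadditive.

(** * Assouad dimension and regularity *)

Section assouad_dimension.
Context {R : realType} {X : metricType R}.
Implicit Types (E : set X) (a s : R).

Lemma assouad_dim_ge0 E : (0 <= assouad_dim E)%E.
Proof. by apply: le_ereal_inf_tmp => _ [s [s0 _] <-]; rewrite lee_fin. Qed.

Lemma assouad_dim_le E s : 0 <= s -> assouad_exponent E s ->
  (assouad_dim E <= s%:E)%E.
Proof. by move=> s0 sE; apply: ereal_inf_lbound; exists s. Qed.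

Lemma exists_assouad_exponent E a : (assouad_dim E < a%:E)%E ->
  exists s, [/\ 0 <= s, assouad_exponent E s & s < a].
Proof.
by move=> /ereal_inf_lt[_ [s [s0 sE] <-]]; rewrite lte_fin => sa; exists s.
Qed.

End assouad_dimension.

(** An Aikawa type condition: seen from E, the mean of a negative power is no
larger than if the distance were comparable to the radius. *)
Definition average_growth {d : measure_display} {R : realType}
    {X : borelMetricType d R} (mu : {measure set X -> \bar R}) (E : set X)
    (b C : R) : Prop :=
  forall (e : X) (r : R), E e -> 0 < r ->
    (r%:E < 4%:E * diam [set: X])%E ->
    (average mu (ball e r) (fun y => epow (dist_set E y)%:E (- b)) <=
     (C * r `^ (- b))%:E)%E.

Section regular_space.
Context {d : measure_display} {R : realType} {X : borelMetricType d R}.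
Context {mu : {measure set X -> \bar R}}.
Implicit Types (x y e : X) (r t g s : R) (A D E : set X).

Lemma measure_le A D : measurable A -> measurable D -> A `<=` D ->
  (mu A <= mu D)%E.
Proof. by move=> mA mD; apply: le_measure; rewrite inE. Qed.

(** A set of positive measure is not contained in the exceptional null set of an
essential upper bound. *)
Lemma le_ess_sup_on D A (f : X -> \bar R) (c : \bar R) : measurable A ->
  A `<=` D -> (0 < mu A)%E -> (forall y, A y -> (c <= f y)%E) ->
  (c <= ess_sup_on mu D f)%E.
Proof.
move=> mA AD muA cf; apply: le_ereal_inf_tmp => u [N [mN N0 subN]].
apply: contrapT => cu; move: muA; rewrite ltNge => /negP; apply.
rewrite -N0; apply: measure_le => // y Ay; apply: subN => /= fu.
by apply: cu; apply: le_trans (cf y Ay) (fu _); exact: AD.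
Qed.

Lemma measure_le_cover A (c : seq X) t (m : R) : measurable A ->
  (forall y, (mu (ball y t) <= m%:E)%E) ->
  A `<=` \bigcup_(y in [set` c]) ball y t ->
  (mu A <= ((size c)%:R * m)%:E)%E.
Proof.
move=> + mball; elim: c A => [|y c IH] A mA Ac.
  by rewrite mul0r (_ : A = set0) ?measure0// -subset0 => x /Ac[].
have mB := @measurable_ball_metric _ _ X y t.
rewrite -[A](setUIDK _ (ball y t)) /= -natr1 mulrDl mul1r addrC EFinD.
have mAB := measurableI _ _ mA mB; have mAD := measurableD mA mB.
apply: le_trans; [exact: measureU2|apply: leeD].
  by apply: le_trans (mball y); apply: measure_le => //; exact: subIsetr.
apply: IH => // x [/Ac[z /= +] zx ny]; rewrite inE => /orP[/eqP zy|zc].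
  by rewrite zy in zx.
by exists z.
Qed.

Context (two_points : exists x y : X, x <> y) (mu_doubling : doubling mu).
Context {Q : R} (Q_gt0 : 0 < Q) (mu_regular : ahlfors_regular mu Q).

Lemma lt_mul_diam (k r : R) : 0 < k -> (r%:E < k%:E * diam [set: X])%E ->
  ((r / k)%:E < diam [set: X])%E.
Proof.
move=> k0; have := diam_gt0 two_points.
case: (diam _) => [D| |]// _; last by rewrite ltry.
by rewrite -EFinM !lte_fin ltr_pdivrMr// mulrC.
Qed.

(** After the reduction of the radius below two diameters, one doubling step
leads back to the range of the regularity hypothesis. *)
Lemma ball_measure_le :
  exists2 C, 0 < C & forall x r, 0 < r -> (mu (ball x r) <= (C * r `^ Q)%:E)%E.
Proof.
have [CD CD0 doub] := mu_doubling; have [C C1 reg] := mu_regular.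
have C0 := lt_le_trans ltr01 C1.
exists (CD * C); first exact: mulr_gt0.
move=> x r r0; have [r' /andP[r'0 r'r] [r'D ->]] :=
  ball_radius_lt_diam x r two_points r0.
have r2 : 0 < r' / 2 by rewrite divr_gt0.
have := doub x _ r2; rewrite mulrC divfK// => /le_trans; apply.
have /andP[_ up] := reg x _ r2 (lt_mul_diam 2 r' (ltr0Sn _ 1) r'D).
rewrite -mulrA EFinM lee_pmul2l ?lte_fin//; apply: le_trans up _.
rewrite lee_fin ler_pM2l//; apply: ge0_ler_powR; rewrite ?nnegrE ?ltW//; lra.
Qed.

(** Shrinking the ball by 4 extends the lower bound to radii below four
diameters.  Such radii occur because covers of a ball of radius r below two
diameters are compared with integrals over the ball of radius 2 r. *)
Lemma ball_measure_ge :
  exists2 k, 0 < k & forall x r, 0 < r -> (r%:E < 4%:E * diam [set: X])%E ->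
    ((k * r `^ Q)%:E <= mu (ball x r))%E.
Proof.
have [C C1 reg] := mu_regular; have C0 := lt_le_trans ltr01 C1.
exists (C^-1 * 4^-1 `^ Q); first by rewrite mulr_gt0 ?powR_gt0 ?invr_gt0.
move=> x r r0 rD; have r4 : 0 < r / 4 by rewrite divr_gt0.
have /andP[low _] := reg x _ r4 (lt_mul_diam 4 r (ltr0Sn _ 3) rD).
rewrite -mulrA -powRMg ?invr_gt0// mulrC [4^-1 * _]mulrC.
rewrite mulrC; apply: le_trans low _.
apply: measure_le; [exact: measurable_ball_metric..|].
by apply: ball_sub; rewrite mdistxx; lra.
Qed.

Context (E : set X).

(** The covering property defining the exponent s holds for all centres and all
radii, not only for centres in E and radii below two diameters. *)
Lemma assouad_cover s : 0 <= s -> assouad_exponent E s ->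
  exists2 C, 0 < C & forall x t r, 0 < t -> t <= r ->
    exists2 c : seq X, (size c)%:R <= C * (t / r) `^ (- s) &
      E `&` ball x r `<=` \bigcup_(y in [set` c]) ball y t.
Proof.
move=> s0 [C C1 cover]; have C0 := lt_le_trans ltr01 C1.
exists (C * 2^-1 `^ (- s)); first by rewrite mulr_gt0 ?powR_gt0 ?invr_gt0.
move=> x t r t0 tr; have r0 := lt_le_trans t0 tr.
rewrite -mulrA -powRMg ?invr_gt0 ?divr_gt0//.
have [[e [Ee xe]]|none] := pselect (E `&` ball x r !=set0); last first.
  exists [::]; first by rewrite mulr_ge0 ?powR_ge0// ltW.
  by move=> y Ey; case: none; exists y.
have r2 : 0 < 2 * r by rewrite mulr_gt0.
have [rho /andP[rho0 rhor] [rhoD eball]] :=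
  ball_radius_lt_diam e _ two_points r2.
have sub : E `&` ball x r `<=` E `&` ball e rho.
  move=> y [Ey xy]; split=> //; rewrite -eball; apply: ball_sub xy.
  by move/ballP : xe; rewrite metric_sym; lra.
have t2r : 2^-1 * (t / r) = t / (2 * r) by field; rewrite gt_eqF.
have [rhot|trho] := leP rho t.
  exists [:: e] => /=.
    apply: le_trans (_ : C * 1 <= _); first by rewrite mulr1.
    rewrite ler_pM2l//.
    apply: le_trans (_ : 1 `^ (- s) <= _); first by rewrite powR1.
    apply: ler_powR_neg; rewrite ?oppr_le0//.
      by rewrite mulr_gt0 ?invr_gt0 ?divr_gt0.
    by rewrite t2r ler_pdivrMr//; lra.
  move=> y /sub[_ ey]; exists e; first by rewrite /= mem_head.
  by apply: ball_sub ey; rewrite mdistxx add0r.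
have [c [csize ccov]] := cover e t rho Ee t0 trho rhoD.
exists c; last exact: subset_trans sub ccov.
apply: le_trans csize _; rewrite ler_pM2l//.
apply: ler_powR_neg; rewrite ?oppr_le0//; first by rewrite t2r divr_gt0.
by rewrite t2r ler_pM2l// lef_pV2 ?posrE.
Qed.

Context (E_neq0 : E !=set0).

(** A point of the ball at distance less than t from E lies within 2 t of the
centre of some ball of a t-cover of E, so the measure is at most the number
(r/t)^s of those balls times t^Q. *)
Lemma neighborhood_measure s : 0 <= s -> assouad_exponent E s ->
  exists2 C, 0 < C & forall x t r, 0 < t -> t <= r ->
    (mu (ball x r `&` [set y | (dist_set E y < t)%R]) <=
     (C * (t / r) `^ (Q - s) * r `^ Q)%:E)%E.
Proof.
move=> s0 /(assouad_cover s s0)[C C0 cover]; have [K K0 up] := ball_measure_le.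
exists (C * 2^-1 `^ (- s) * (K * 2 `^ Q)).
  by rewrite !mulr_gt0 ?powR_gt0 ?invr_gt0.
move=> x t r t0 tr; have r0 := lt_le_trans t0 tr.
have t2 : 0 < 2 * t by rewrite mulr_gt0.
have t2r : t <= 2 * r by lra.
have [c csize ccov] := cover x t (2 * r) t0 t2r.
have mA : measurable (ball x r `&` [set y | dist_set E y < t]).
  apply: measurableI; first exact: measurable_ball_metric.
  exact: measurable_dist_lt.
apply: le_trans (measure_le_cover _ c (2 * t) (K * (2 * t) `^ Q) mA _ _) _.
- by move=> y; exact: up.
- move=> y [/ballP xy /(dist_set_lt E E_neq0)[e Ee ye]].
  have [|z zc /ballP ze] := ccov e.
    split=> //; apply/ballP/(le_lt_trans (metric_triangle x y e)); lra.
  exists z => //; apply/ballP/(le_lt_trans (metric_triangle z e y)).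
  by rewrite [mdist e y]metric_sym; lra.
rewrite lee_fin.
apply: le_trans (ler_wpM2r _ csize) _.
  by rewrite mulr_ge0 ?powR_ge0// ltW.
have -> : t / (2 * r) = 2^-1 * (t / r) by field; rewrite gt_eqF.
have {2}-> : t = (t / r) * r by rewrite divfK// gt_eqF.
have q0 : 0 < t / r by rewrite divr_gt0.
set q := t / r in q0 *.
rewrite (powRDg q Q (- s))// !powRMg ?mulr_gt0 ?invr_gt0//.
by rewrite le_eqVlt; apply/orP; left; apply/eqP; ring.
Qed.

Context (dimE_ltQ : (assouad_dim E < Q%:E)%E) (E_closed : closed E).

Lemma measurable_closed_set : measurable E.
Proof. by rewrite -[E]setCK; apply/measurableC/open_borel/closed_openC. Qed.

(** On a bounded ball, E lies in all neighbourhoods {delta < t}, whose measure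
tends to 0 with t because Q - s > 0. *)
Lemma measure_assouad_eq0 : mu E = 0%E.
Proof.
have mE := measurable_closed_set.
apply: measure_negligible => //.
have [x0 _] := E_neq0.
have -> : E = \bigcup_n (E `&` ball x0 n.+1%:R).
  apply/seteqP; split=> [x Ex|x [n _ []]//].
  exists (Num.truncn (mdist x0 x)) => //; split=> //; apply/ballP.
  exact: truncnS_gt.
apply: negligible_bigcup => n; have n0 : 0 < n.+1%:R :> R by [].
have mEn : measurable (E `&` ball x0 n.+1%:R).
  by apply: measurableI => //; exact: measurable_ball_metric.
apply/negligibleP => //; apply/eqP; rewrite eq_le measure_ge0 andbT.
have [s [s0 sE sQ]] := exists_assouad_exponent _ _ dimE_ltQ.
have [C C0 nb] := neighborhood_measure s s0 sE.
have a0 : 0 < Q - s by rewrite subr_gt0.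
apply/lee_addgt0Pr => eps eps0; rewrite add0e.
have K0 : 0 < C * n.+1%:R `^ Q by rewrite mulr_gt0 ?powR_gt0.
have [q /andP[q0 q1] qe] :=
  exists_powR_le (Q - s) _ a0 (divr_gt0 eps0 K0).
apply: le_trans (_ : (mu (ball x0 n.+1%:R `&`
    [set y | (dist_set E y < q * n.+1%:R)%R]) <= _)%E).
  apply: measure_le => //.
    apply: measurableI; first exact: measurable_ball_metric.
    exact: measurable_dist_lt.
  by move=> y [Ey ?]; split=> //=; rewrite dist_set_in// mulr_gt0.
apply: le_trans (nb _ _ _ _ _) _; first by rewrite mulr_gt0.
  by rewrite ger_pMl// ltW.
by rewrite lee_fin mulfK ?gt_eqF// mulrAC -ler_pdivlMl// mulrC.
Qed.

(** For c small the points with delta < c r fill at most half of the ball. *)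
Lemma porosity : exists c k, [/\ 0 < c < 1, 0 < k & forall x r, 0 < r ->
  (r%:E < 4%:E * diam [set: X])%E ->
  ((k * r `^ Q)%:E <=
   mu (ball x r `&` [set y | (c * r <= dist_set E y)%R]))%E].
Proof.
have [s [s0 sE sQ]] := exists_assouad_exponent _ _ dimE_ltQ.
have [C C0 nb] := neighborhood_measure s s0 sE.
have [k k0 low] := ball_measure_ge.
have a0 : 0 < Q - s by rewrite subr_gt0.
have k20 : 0 < k / 2 / C by rewrite !divr_gt0.
have [c /andP[c0 c1] cs] := exists_powR_le _ _ a0 k20.
exists c, (k / 2); split; [by rewrite c0|by rewrite divr_gt0|].
move=> x r r0 rD; have cr0 : 0 < c * r by rewrite mulr_gt0.
have crr : c * r <= r by rewrite ger_pMl// ltW.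
have := nb x (c * r) r cr0 crr; have := low x r r0 rD.
have mB := @measurable_ball_metric _ _ X x r.
rewrite (measureDI mu mB (measurable_dist_lt E E_neq0 (c * r))).
rewrite mulfK ?gt_eqF//.
rewrite setDE (_ : ~` _ = [set y | c * r <= dist_set E y]); last first.
  by apply/seteqP; split=> y /=; rewrite leNgt => /negP.
set A := mu _; set B := mu _; move=> AB Bs.
have {}Bs : (A <= (k / 2 * r `^ Q)%:E)%E.
  apply: le_trans Bs _; rewrite lee_fin ler_wpM2r ?powR_ge0//.
  by rewrite -ler_pdivlMl// mulrC.
have := le_trans AB (leeD2l B Bs).
case: B {AB} => [u|_|]; [|exact: leey|by rewrite addNye !leeNy_eq].
by rewrite -EFinD !lee_fin; lra.
Qed.

(** * Upper bounds for averages, and sufficiency *)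

(** Up to the null set E the ball is the union of the layers where delta is
about 3 r 2^(-k); the k-th contributes at most a constant times
r^(Q+g) 2^(-k(Q-s+g)), which is summable for an exponent s < Q + g. *)
Lemma near_integral g : g < 0 -> (assouad_dim E < (Q + g)%:E)%E ->
  exists2 C, 0 < C & forall x r, 0 < r -> dist_set E x < 2 * r ->
    (\int[mu]_(y in ball x r) epow (dist_set E y)%:E g <=
     (C * r `^ (Q + g))%:E)%E.
Proof.
move=> g0 /exists_assouad_exponent[s [s0 sE sQg]].
have [C C0 nb] := neighborhood_measure s s0 sE.
pose q : R := 2^-1 `^ (Q - s + g).
have h01 : 0 < (2^-1 : R) < 1 by rewrite invr_gt0 ltr0n invf_lt1// ltr1n.
have /andP[h0 h1] := h01.
have ag0 : 0 < Q - s + g by lra.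
have q0 : 0 < q by rewrite powR_gt0.
have q1 : q < 1.
  rewrite -[ltRHS](congr1 (fun f => f (Q - s + g)) (powR1 R)).
  by apply: gt0_ltr_powR => //; rewrite ?nnegrE ?ler01 ?(ltW h0).
pose K := C * 3 `^ Q * (3 / 2) `^ g.
have K0 : 0 < K by rewrite !mulr_gt0 ?powR_gt0 ?divr_gt0.
exists (K / (1 - q)); first by rewrite divr_gt0 ?subr_gt0.
move=> x r r0 xr.
(* delta < 3 r on the ball, so the layers start at 3 r *)
pose t k := 3 * r * 2^-1 ^+ k.
have t0 k : 0 < t k by rewrite !mulr_gt0 ?exprn_gt0.
have tS k : t k.+1 = (3 / 2) * r * 2^-1 ^+ k.
  by rewrite /t exprS; field.
pose F k := ball x r `&`
  ([set y | t k.+1 <= dist_set E y] `&` [set y | dist_set E y < t k]).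
have mB := @measurable_ball_metric _ _ X x r.
have mF k : measurable (F k).
  apply: measurableI => //; apply: measurableI.
    exact: measurable_dist_ge.
  exact: measurable_dist_lt.
have mE := measurable_closed_set.
rewrite (ge0_negligible_integral mE)//; last 3 first.
- exact: measurable_epow_dist.
- by move=> y _; exact: epow_ge0.
- exact: measure_assouad_eq0.
have t_anti k l : (k <= l)%N -> t l <= t k.
  move=> kl; rewrite /t ler_pM2l ?mulr_gt0//.
  by apply: ler_wiXn2l => //; rewrite ?invf_le1 ?ltW// ltr1n.
have -> : ball x r `\` E = \bigcup_k F k.
  apply/seteqP; split=> [y [xy nEy]|y [k _ [xy [/= tk _]]]]; last first.
    split=> // Ey; move: tk; rewrite dist_set_in// leNgt.
    by rewrite t0.
  have dy0 : 0 < dist_set E y.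
    by rewrite ltNge; apply/negP => /(dist_set_eq0 E E_neq0 y E_closed).
  have ex : exists n, t n <= dist_set E y.
    have r3 : 0 < 3 * r by rewrite mulr_gt0.
    have [n hn] := exists_exprn_le _ _ h01 (divr_gt0 dy0 r3).
    by exists n; rewrite /t mulrC -ler_pdivlMr.
  case: (ex_minnP ex) => -[|m] tm mmin.
    move: tm; rewrite /t expr0 mulr1 leNgt => /negP[].
    by have [] := dist_set_ball E E_neq0 x y r xy; lra.
  exists m => //; split=> //; split=> //=.
  by rewrite ltNge; apply/negP => /mmin; rewrite ltnn.
rewrite ge0_integral_bigcup//; last 3 first.
- exact: measurable_epow_dist.
- by move=> y _; exact: epow_ge0.
- apply: ltn_trivIset => l k kl; rewrite -subset0 => y.
  move=> [[_ [/= + _]] [_ [/= _ +]]] => tky ytl.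
  by have := lt_le_trans ytl (le_trans (t_anti _ _ kl) tky); rewrite ltxx.
apply: le_trans (_ : (\sum_(0 <= k <oo) (K * r `^ (Q + g) * q ^+ k)%:E <= _)%E).
  apply: lee_nneseries => k _; first by rewrite integral_ge0// => *; exact: epow_ge0.
  apply: le_trans (_ : (\int[mu]_(y in F k) (t k.+1 `^ g)%:E <= _)%E).
    apply: ge0_le_integral => //.
    + by move=> *; exact: epow_ge0.
    + exact: measurable_epow_dist.
    + by move=> y [_ [/= ty _]]; apply: epow_le_neg => //; exact: ltW.
  rewrite integral_cst//.
  (* the decay needs t k <= radius, hence the passage to the ball of radius 3 r *)
  have t3 : t k <= 3 * r.
    by rewrite -[leRHS]mulr1 -(expr0 (2^-1 : R)); exact: t_anti.
  have r3 : 0 < 3 * r by rewrite mulr_gt0.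
  apply: le_trans (_ : (t k.+1 `^ g)%:E *
      (C * (t k / (3 * r)) `^ (Q - s) * (3 * r) `^ Q)%:E <= _)%E.
    rewrite lee_pmul2l ?lte_fin ?powR_gt0//.
    apply: le_trans (nb x _ _ (t0 k) t3); apply: measure_le => //.
      apply: measurableI; first exact: measurable_ball_metric.
      exact: measurable_dist_lt.
    move=> y [xy [_ ty]]; split=> //; apply: ball_sub xy.
    by rewrite mdistxx; lra.
  rewrite -EFinM lee_fin tS /t (mulrC (3 * r)) mulfK ?gt_eqF//.
  rewrite le_eqVlt; apply/orP; left; apply/eqP.
  rewrite /K /q !powRMg ?divr_gt0 ?mulr_gt0 ?exprn_gt0// !powRX ?(ltW h0)//.
  by rewrite !powRDg// !exprMn; ring.
apply: le_trans (nneseries_geometric_le _ _ _ _) _; rewrite ?q0//.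
  by rewrite mulr_ge0 ?powR_ge0// ltW.
by rewrite mulrAC.
Qed.

Lemma lt_diam_widen (r : R) : (r%:E < 2%:E * diam [set: X])%E ->
  (r%:E < 4%:E * diam [set: X])%E.
Proof.
move=> /lt_le_trans; apply; apply: lee_wpmul2r; last by rewrite lee_fin ler_nat.
exact/ltW/(diam_gt0 two_points).
Qed.

Lemma lt_diam_double (r : R) : (r%:E < 2%:E * diam [set: X])%E ->
  ((2 * r)%:E < 4%:E * diam [set: X])%E.
Proof.
have := diam_gt0 two_points; case: (diam _) => [D| |]// _.
  by rewrite -!EFinM !lte_fin; lra.
by move=> _; rewrite gt0_muley ?lte_fin// ltry.
Qed.

Lemma integral_superadditive (f : X -> \bar R) A D :
  measurable_fun [set: X] f -> (forall y, 0 <= f y)%E ->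
  measurable A -> measurable D -> A `<=` D ->
  (\int[mu]_(y in A) f y + \int[mu]_(y in D `\` A) f y <=
   \int[mu]_(y in D) f y)%E.
Proof.
move=> mf f0 mA mD AD.
rewrite -{2}(setDUK AD) ge0_integral_setU//; first exact: measurableD.
- exact: measurable_funTS.
- by apply/disj_setPS => y [Ay []].
Qed.

Lemma measure_superadditive A D : measurable A -> measurable D -> A `<=` D ->
  (mu A + mu (D `\` A) <= mu D)%E.
Proof.
move=> mA mD AD; rewrite -{2}(setDUK AD) measureU//; first exact: measurableD.
by rewrite setDIK.
Qed.

Context (mu_ball : forall x r, 0 < r -> (0 < mu (ball x r) < +oo)%E).

Lemma averageE x r (f : X -> \bar R) : 0 < r ->
  exists2 m, 0 < m & mu (ball x r) = m%:E /\
    average mu (ball x r) f = (m^-1%:E * \int[mu]_(y in ball x r) f y)%E.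
Proof.
move=> /(mu_ball x); rewrite /average.
case: (mu _) => [m| |]//; last by rewrite ltxx andbF.
by rewrite lte_fin => /andP[m0 _]; exists m => //; rewrite inver gt_eqF.
Qed.

Lemma average_le_cst x r (f : X -> \bar R) M : 0 < r ->
  measurable_fun (ball x r) f -> (forall y, 0 <= f y)%E ->
  (forall y, ball x r y -> f y <= M%:E)%E ->
  (average mu (ball x r) f <= M%:E)%E.
Proof.
move=> r0 mf f0 fM; have [m m0 [mB ->]] := averageE x r f r0.
have mball := @measurable_ball_metric _ _ X x r.
rewrite lee_pdivrMl// muleC -mB -integral_cst//.
by apply: ge0_le_integral.
Qed.

(** Let M = max(r, delta x).  If g >= 0, use that delta <= 2 M on the ball.  If
g < 0, either the ball is far from E and delta >= M / 2 on it, or M <= 2 r and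
[near_integral] applies. *)
Lemma average_epow_le g : (assouad_dim E < (Q + g)%:E)%E ->
  exists2 C, 0 < C & forall x r, 0 < r ->
    (r%:E < 4%:E * diam [set: X])%E ->
    (average mu (ball x r) (fun y => epow (dist_set E y)%:E g) <=
     (C * Num.max r (dist_set E x) `^ g)%:E)%E.
Proof.
move=> ag0; have [g0|g0] := leP 0 g.
  exists (2 `^ g); first by rewrite powR_gt0.
  move=> x r r0 _; set M := Num.max _ _.
  have rM : r <= M by rewrite le_max lexx.
  have xM : dist_set E x <= M by rewrite le_max lexx orbT.
  have M0 := lt_le_trans r0 rM.
  rewrite -powRMg//; apply: average_le_cst => //.
  - exact: measurable_epow_dist.
  - by move=> y; exact: epow_ge0.
  move=> y /(dist_set_ball E E_neq0)[xy _].
  by apply: epow_le => //; [exact: dist_set_ge0|lra].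
have [C C0 near] := near_integral g g0 ag0.
have [k k0 low] := ball_measure_ge.
exists (2^-1 `^ g * (1 + C / k)).
  by rewrite mulr_gt0 ?powR_gt0 ?invr_gt0// addr_gt0// divr_gt0.
move=> x r r0 rD; set M := Num.max _ _.
have rM : r <= M by rewrite le_max lexx.
have M0 := lt_le_trans r0 rM.
have h0 : 0 < 2^-1 :> R by rewrite invr_gt0.
have Mg0 : 0 < (2^-1 * M) `^ g by rewrite powR_gt0// mulr_gt0.
have Ck0 : 0 < C / k by rewrite divr_gt0.
rewrite mulrAC -powRMg//.
have [far|close] := leP (2 * r) (dist_set E x).
  have ME : M = dist_set E x by apply/max_idPr; lra.
  apply: (@le_trans _ _ ((2^-1 * M) `^ g)%:E).
    apply: average_le_cst => //.
    - exact: measurable_epow_dist.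
    - by move=> y; exact: epow_ge0.
    move=> y /(dist_set_ball E E_neq0)[_ xy].
    by apply: epow_le_neg; rewrite ?ltW ?mulr_gt0//; lra.
  by rewrite lee_fin ler_peMr ?ltW//; lra.
have Mr : 2^-1 * M <= r.
  suff : M <= 2 * r by lra.
  by rewrite /M ge_max; apply/andP; split; lra.
have [m m0 [mB ->]] := averageE x r (fun y => epow (dist_set E y)%:E g) r0.
have rQm : k * r `^ Q <= m by rewrite -lee_fin -mB; exact: low.
rewrite lee_pdivrMl//; apply: le_trans (near x r r0 close) _.
rewrite -EFinM lee_fin powRDg//.
apply: (@le_trans _ _ (C / k * (k * r `^ Q) * r `^ g)).
  by rewrite [C / k * _]mulrA divfK ?gt_eqF// mulrA.
apply: (@le_trans _ _ (C / k * m * (2^-1 * M) `^ g)).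
  apply: ler_pM; rewrite ?powR_ge0//.
  - by rewrite !mulr_ge0 ?powR_ge0 ?invr_ge0 ?ltW.
  - by rewrite ler_pM2l.
  - by apply: ler_powR_neg => //; [exact: ltW|rewrite mulr_gt0].
rewrite [C / k * m]mulrC -mulrA ler_pM2l// mulrC ler_pM2l//; lra.
Qed.

Lemma average_epow_ge g : 0 <= g ->
  exists2 k, 0 < k & forall x r, 0 < r ->
    (r%:E < 4%:E * diam [set: X])%E ->
    ((k * r `^ g)%:E <=
     average mu (ball x r) (fun y => epow (dist_set E y)%:E g))%E.
Proof.
move=> g0; have [c [k [/andP[c0 _] k0 por]]] := porosity.
have [C C0 up] := ball_measure_le.
exists (c `^ g * k / C); first by rewrite divr_gt0 ?mulr_gt0 ?powR_gt0.
move=> x r r0 rD; set f := fun y => _.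
have [m m0 [mB ->]] := averageE x r f r0.
have mr : m <= C * r `^ Q by rewrite -lee_fin -mB; exact: up.
have mball := @measurable_ball_metric _ _ X x r.
pose S := ball x r `&` [set y | c * r <= dist_set E y].
have mS : measurable S.
  by apply: measurableI => //; exact: measurable_dist_ge.
have f0 y : (0 <= f y)%E by exact: epow_ge0.
have mf D : measurable_fun D f by exact: measurable_epow_dist.
rewrite lee_pdivlMl//.
apply: le_trans (_ : (\int[mu]_(y in S) f y <= _)%E); last first.
  by apply: ge0_subset_integral => //; exact: subIsetl.
apply: le_trans (_ : (\int[mu]_(y in S) ((c * r) `^ g)%:E <= _)%E); last first.
  apply: ge0_le_integral => //.
  - by move=> y _; rewrite lee_fin powR_ge0.
  - by move=> y [_ /= cy]; apply: epow_ge => //; rewrite mulr_ge0// ltW.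
rewrite integral_cst//.
apply: le_trans (_ : (((c * r) `^ g)%:E * (k * r `^ Q)%:E <= _)%E); last first.
  by rewrite lee_pmul2l ?lte_fin ?powR_gt0 ?mulr_gt0//; exact: por.
rewrite -!EFinM lee_fin powRMg//.
apply: (@le_trans _ _ (C * r `^ Q * (c `^ g * k / C * r `^ g))).
  by rewrite ler_wpM2r// !mulr_ge0 ?powR_ge0 ?invr_ge0 ?ltW.
rewrite le_eqVlt; apply/orP; left; apply/eqP; field.
by rewrite gt_eqF.
Qed.

Lemma weight_dist_weight alpha : (assouad_dim E < (Q - alpha)%:E)%E ->
  weight mu (dist_weight E alpha).
Proof.
move=> dim; split; first exact: measurable_epow_dist.
  exists E; split; [exact: measurable_closed_set|exact: measure_assouad_eq0|].
  move=> x /= xw; apply: contrapT => nEx; apply: xw.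
  rewrite /dist_weight epowE ?lte_fin ?powR_gt0// ltNge;
  by apply/negP => /(dist_set_eq0 E E_neq0 x E_closed).
move=> x r r0.
have [r' /andP[r'0 _] [r'D ->]] := ball_radius_lt_diam x r two_points r0.
have [C C0 avg] := average_epow_le (- alpha) dim.
have := avg x r' r'0 (lt_diam_widen r' r'D).
have [m m0 [mB ->]] := averageE x r' (dist_weight E alpha) r'0.
rewrite lee_pdivrMl// => /le_lt_trans; apply; exact: ltry.
Qed.

Lemma average_ge0 x r (f : X -> \bar R) : 0 < r -> (forall y, 0 <= f y)%E ->
  (0 <= average mu (ball x r) f)%E.
Proof.
move=> r0 f0; have [m m0 [mB ->]] := averageE x r f r0.
by rewrite mule_ge0 ?integral_ge0// lee_fin invr_ge0 ltW.
Qed.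

Lemma dist_weight_dual alpha p : 1 < p ->
  (fun y => epow (dist_weight E alpha y) (- (1 / (p - 1)))) =
  (fun y => epow (dist_set E y)%:E (alpha / (p - 1))).
Proof.
move=> p1; apply/funext => y; rewrite /dist_weight epow_epow.
- by congr (epow _ _); rewrite mulrNN mul1r.
- exact: dist_set_ge0.
- by rewrite oppr_lt0 divr_gt0// subr_gt0.
Qed.

Lemma le_poweR (u v : \bar R) g : 0 <= g -> (0 <= u)%E -> (u <= v)%E ->
  (u `^ g <= v `^ g)%E.
Proof.
move=> g0 u0 uv; apply: gt0_ler_poweR => //; rewrite in_itv /= leey andbT//.
exact: le_trans uv.
Qed.

(** With M = max(r, delta x), the two factors are at most C1 M^(-alpha) and
(C2 M^(alpha/(p-1)))^(p-1), and M cancels. *)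
Lemma muckenhoupt_dist_weight p alpha : 1 < p ->
  (assouad_dim E < (Q - alpha)%:E)%E ->
  (assouad_dim E < (Q + alpha / (p - 1))%:E)%E ->
  muckenhoupt mu p (dist_weight E alpha).
Proof.
move=> p1 dim1 dim2; split; first exact: weight_dist_weight.
rewrite dist_weight_dual//; have p10 : 0 < p - 1 by rewrite subr_gt0.
have [C1 C10 avg1] := average_epow_le (- alpha) dim1.
have [C2 C20 avg2] := average_epow_le (alpha / (p - 1)) dim2.
exists (C1 * C2 `^ (p - 1)); first by rewrite mulr_gt0 ?powR_gt0.
move=> x r r0.
have [r' /andP[r'0 _] [r'D ->]] := ball_radius_lt_diam x r two_points r0.
have r'D4 := lt_diam_widen r' r'D.
have := avg1 x r' r'0 r'D4; have := avg2 x r' r'0 r'D4.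
set M := Num.max _ _; have M0 : 0 < M by rewrite lt_max r'0.
move=> /le_poweR => /(_ (p - 1) (ltW p10)) le2 le1.
apply: le_trans (lee_pmul _ _ le1 (le2 _)) _.
- by apply: average_ge0 => // y; exact: epow_ge0.
- exact: poweR_ge0.
- by apply: average_ge0 => // y; exact: epow_ge0.
rewrite poweR_EFin -EFinM lee_fin powRMg ?powR_gt0//.
rewrite -powRrM divfK ?gt_eqF// powRN.
rewrite le_eqVlt; apply/orP; left; apply/eqP; field.
by rewrite gt_eqF ?powR_gt0.
Qed.

Lemma muckenhoupt1_dist_weight alpha : 0 <= alpha ->
  (assouad_dim E < (Q - alpha)%:E)%E ->
  muckenhoupt1 mu (dist_weight E alpha).
Proof.
move=> alpha0 dim; split; first exact: weight_dist_weight.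
have [C C0 avg] := average_epow_le (- alpha) dim.
exists (C * 2 `^ alpha); first by rewrite mulr_gt0 ?powR_gt0.
move=> x r r0.
have [r' /andP[r'0 _] [r'D ->]] := ball_radius_lt_diam x r two_points r0.
have r'D4 := lt_diam_widen r' r'D.
have := avg x r' r'0 r'D4.
set M := Num.max _ _; have M0 : 0 < M by rewrite lt_max r'0.
have rM : r' <= M by rewrite le_max lexx.
have xM : dist_set E x <= M by rewrite le_max lexx orbT.
move=> le1.
apply: le_trans (_ : ((C * M `^ (- alpha))%:E * ((2 * M) `^ alpha)%:E <= _)%E).
  apply: lee_pmul => //.
  - by apply: average_ge0 => // y; exact: epow_ge0.
  - apply: (le_ess_sup_on _ (ball x r')) => //.
    + exact: measurable_ball_metric.
    + by have /andP[] := mu_ball x r' r'0.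
    + by move=> y _; rewrite inve_ge0; exact: epow_ge0.
  apply: ereal_inf_lbound; apply: aeW => y /(dist_set_ball E E_neq0)[yx _].
  rewrite /dist_weight inve_epow ?dist_set_ge0// opprK.
  by apply: epow_le => //; [exact: dist_set_ge0|lra].
rewrite -EFinM lee_fin powRMg// powRN.
rewrite le_eqVlt; apply/orP; left; apply/eqP; field.
by rewrite gt_eqF ?powR_gt0.
Qed.

(** * Self-improvement *)

(** The factor 2 leaves room for balls of radius t <= r centred in ball e r. *)
Definition layer e r c t : set X := ball e (2 * r) `&`
  ([set y | c * t <= dist_set E y] `&` [set y | dist_set E y < t]).

Lemma measurable_layer e r c t : measurable (layer e r c t).
Proof.
apply: measurableI; first exact: measurable_ball_metric.
by apply: measurableI; [exact: measurable_dist_ge|exact: measurable_dist_lt].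
Qed.

(** The balls of radius t around the points of a packing at scale 2 t are
disjoint, the layer keeps a fixed share of each of them by porosity, and there
delta^(-b) >= t^(-b). *)
Lemma packing_layer_integral b c k e r t (P : seq X) : 0 < b -> 0 < c ->
  (forall x r, 0 < r -> (r%:E < 4%:E * diam [set: X])%E ->
    ((k * r `^ Q)%:E <=
     mu (ball x r `&` [set y | (c * r <= dist_set E y)%R]))%E) ->
  0 < t -> t <= r -> (t%:E < 4%:E * diam [set: X])%E ->
  packing (E `&` ball e r) (2 * t) P ->
  (((size P)%:R * (k * t `^ (Q - b)))%:E <=
   \int[mu]_(y in layer e r c t) epow (dist_set E y)%:E (- b))%E.
Proof.
move=> b0 c0 por t0 tr tD [Puniq PE Psep].
have mL := measurable_layer e r c t.
apply: le_trans (_ : (\int[mu]_(y in layer e r c t) (t `^ (- b))%:E <= _)%E);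
    last first.
  apply: ge0_le_integral => //.
  - by move=> y _; rewrite lee_fin powR_ge0.
  - exact: measurable_epow_dist.
  - move=> y [_ [_ /= /ltW yt]]; apply: epow_ge_neg => //.
      by rewrite oppr_lt0.
    exact: dist_set_ge0.
rewrite integral_cst//.
have -> : (size P)%:R * (k * t `^ (Q - b)) =
    t `^ (- b) * ((size P)%:R * (k * t `^ Q)) by rewrite powRDg//; ring.
rewrite EFinM lee_pmul2l ?lte_fin ?powR_gt0//.
apply: (superadditive_count mu _ _ _ P
  (fun y => ball y t `&` [set z | c * t <= dist_set E z])) => //.
- exact: measure_superadditive.
- move=> y yP; have [Ey /ballP ey] := PE y yP; split.
    apply: measurableI; first exact: measurable_ball_metric.
    exact: measurable_dist_ge.
  move=> z [/ballP yz /= cz]; split.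
    by apply/ballP/(le_lt_trans (metric_triangle e y z)); lra.
  split=> //=; apply: le_lt_trans yz.
  by rewrite metric_sym; exact: dist_set_le.
- move=> y z yP zP [x [[/ballP yx _] [/ballP zx _]]].
  apply: Psep => //; apply: le_lt_trans (metric_triangle y x z) _.
  by rewrite [mdist x z]metric_sym; lra.
- by move=> y yP; exact: por.
Qed.

(** A bounded total, spread over K disjoint layers, leaves little to one of them:
if no scale were sparse, each layer would contribute at least
(k0 / 2) (r/2)^(Q-b), and K of these exceed the bound for the integral over
B(e, 2 r).  The scale ratio l is the porosity constant c, which makes each
layer start where the next one ends. *)
Lemma exists_sparse_scale b C : 0 < b -> 0 < C -> average_growth mu E b C ->
  exists l K, [/\ 0 < l < 1, (0 < K)%N & forall e r, E e -> 0 < r ->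
    (r%:E < 2%:E * diam [set: X])%E ->
    exists k P, [/\ (0 < k <= K)%N, forall y, y \in P -> E y,
      E `&` ball e r `<=` \bigcup_(y in [set` P]) ball y (l ^+ k * r) &
      (size P)%:R <= 2^-1 * (l ^+ k) `^ (- (Q - b))]].
Proof.
move=> b0 C0 growth; have [c [k0 [/andP[c0 c1] k00 por]]] := porosity.
have [D D0 up] := ball_measure_le.
(* K times the smallest possible layer is below the integral iff K <= J *)
pose J : R := 2 * D * C / k0 * 4 `^ (Q - b).
have J0 : 0 < J by rewrite !mulr_gt0 ?powR_gt0 ?invr_gt0.
exists c, (Num.truncn J).+1; split; [by rewrite c0|by []|].
set K := (Num.truncn J).+1.
move=> e r Ee r0 rD.
pose t k := c ^+ k * r / 2.
have t0 k : 0 < t k by rewrite !mulr_gt0 ?exprn_gt0 ?invr_gt0.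
have t2 k : 2 * t k = c ^+ k * r by rewrite /t mulrC divfK.
have ck1 k : c ^+ k <= 1 by rewrite exprn_ile1// ltW.
have tr k : t k <= r.
  have := ler_wpM2r (ltW r0) (ck1 k); rewrite -t2; have := t0 k; lra.
have tD k : ((t k)%:E < 4%:E * diam [set: X])%E.
  apply: lt_diam_widen.
  by apply: le_lt_trans rD; rewrite lee_fin.
pose f y := epow (dist_set E y)%:E (- b).
have f0 y : (0 <= f y)%E by exact: epow_ge0.
have mf : measurable_fun [set: X] f by exact: measurable_epow_dist.
pose I0 := D * (2 * r) `^ Q * (C * (2 * r) `^ (- b)).
have r2 : 0 < 2 * r by rewrite mulr_gt0.
have int_le : (\int[mu]_(y in ball e (2 * r)) f y <= I0%:E)%E.
  have r2D := lt_diam_double r rD.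
  have [m m0 [mB avgE]] := averageE e (2 * r) f r2.
  have := growth e _ Ee r2 r2D; rewrite avgE lee_pdivrMl// => /le_trans; apply.
  rewrite -EFinM lee_fin; apply: ler_wpM2r; last by rewrite -lee_fin -mB up.
  by rewrite mulr_ge0 ?powR_ge0// ltW.
have mL k := measurable_layer e r c (t k).
have layer_sub k : layer e r c (t k) `<=` ball e (2 * r) by move=> y [].
have mB := @measurable_ball_metric _ _ X e (2 * r).
have layer_le k : (\int[mu]_(y in layer e r c (t k)) f y <= I0%:E)%E.
  apply: le_trans int_le; apply: ge0_subset_integral => //.
  exact: measurable_funTS.
have pack k P : packing (E `&` ball e r) (2 * t k) P ->
    (((size P)%:R * (k0 * t k `^ (Q - b)))%:E <=
     \int[mu]_(y in layer e r c (t k)) f y)%E.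
  by move=> pP; apply: packing_layer_integral => //; exact: tr.
have cover k : exists2 P, packing (E `&` ball e r) (2 * t k) P &
    E `&` ball e r `<=` \bigcup_(y in [set` P]) ball y (2 * t k).
  have kt0 : 0 < k0 * t k `^ (Q - b) by rewrite mulr_gt0 ?powR_gt0.
  apply: (exists_packing_cover _ _ (Num.truncn (I0 / (k0 * t k `^ (Q - b))))).
    by rewrite mulr_gt0.
  move=> P /pack/le_trans/(_ (layer_le k)); rewrite lee_fin.
  rewrite -ler_pdivlMr// => sP.
  by rewrite -ltnS -(ltr_nat R); exact: le_lt_trans sP (truncnS_gt _).
apply: contrapT => none.
pose m := 2^-1 * k0 * (r / 2) `^ (Q - b).
have m_le k : k \in iota 1 K -> (m%:E <= \int[mu]_(y in layer e r c (t k)) f y)%E.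
  rewrite mem_iota add1n => /andP[k1 kK].
  have [P pP covP] := cover k; have [_ PE _] := pP.
  apply: le_trans (pack k P pP); rewrite lee_fin.
  have [small|/ltW large] := leP (size P)%:R (2^-1 * (c ^+ k) `^ (- (Q - b))).
    exfalso; apply: none; exists k, P; split=> //.
    - by rewrite k1.
    - by move=> y /PE[].
    - by rewrite -t2.
  apply: le_trans (ler_wpM2r _ large); last first.
    by rewrite mulr_ge0 ?powR_ge0// ltW.
  have -> : t k = c ^+ k * (r / 2) by rewrite /t mulrA.
  rewrite powRMg ?exprn_gt0 ?divr_gt0// powRN.
  rewrite le_eqVlt; apply/orP; left; apply/eqP; rewrite /m; field.
  by rewrite gt_eqF// powR_gt0// exprn_gt0.
have t_layer k j : (k < j)%N -> t j <= c * t k.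
  move=> kj; rewrite /t mulrA mulrA -exprS !ler_pM2r ?invr_gt0//.
  by apply: ler_wiXn2l => //; exact: ltW.
have layers_disjoint k j x : (k < j)%N -> layer e r c (t k) x ->
    layer e r c (t j) x -> False.
  move=> /t_layer tkj [_ [/= kx _]] [_ [_ /= jx]].
  by have := lt_le_trans jx (le_trans tkj kx); rewrite ltxx.
have : (((size (iota 1 K))%:R * m)%:E <= I0%:E)%E.
  apply: le_trans int_le.
  apply: (superadditive_count (fun A => \int[mu]_(y in A) f y)%E _ _ _ _
    (fun k => layer e r c (t k))) => //.
  - by move=> A; exact: integral_ge0.
  - by move=> A A' mA mA'; exact: integral_superadditive.
  - exact: iota_uniq.
  - move=> k j _ _ [x [kx jx]]; apply/eqP; case: ltngtP => // kj.
      by case: (layers_disjoint _ _ _ kj kx jx).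
    by case: (layers_disjoint _ _ _ kj jx kx).
rewrite size_iota lee_fin.
have -> : I0 = D * C * 4 `^ (Q - b) * (r / 2) `^ (Q - b).
  rewrite -[RHS]mulrA -powRMg ?divr_gt0//.
  have -> : 4 * (r / 2) = 2 * r by field.
  by rewrite /I0 (powRDg (2 * r) Q (- b))//; ring.
rewrite /m mulrA ler_pM2r ?powR_gt0 ?divr_gt0// mulrA -ler_pdivlMr//.
rewrite -ler_pdivlMr ?invr_gt0// invrK.
have -> : D * C * 4 `^ (Q - b) / k0 * 2 = J by rewrite /J; ring.
by rewrite leNgt truncnS_gt.
Qed.

Lemma cover_by_covers (A : set X) (P : seq X) rho t (M : R) :
  (forall y, y \in P -> exists2 c : seq X, (size c)%:R <= M &
     A `&` ball y rho `<=` \bigcup_(z in [set` c]) ball z t) ->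
  A `<=` \bigcup_(y in [set` P]) ball y rho ->
  exists2 c : seq X, (size c)%:R <= (size P)%:R * M &
    A `<=` \bigcup_(z in [set` c]) ball z t.
Proof.
move=> covers AP.
have [c cM cP] : exists2 c : seq X, (size c)%:R <= (size P)%:R * M &
    forall y, y \in P ->
      A `&` ball y rho `<=` \bigcup_(z in [set` c]) ball z t.
  elim: P covers {AP} => [|y P IH] covers; first by exists [::]; rewrite ?mul0r.
  have [c' c'M c'y] := covers y (mem_head _ _).
  have [z zP|c cM cP] := IH; first by apply: covers; rewrite inE zP orbT.
  exists (c' ++ c).
    by rewrite size_cat natrD /= -natr1 mulrDl mul1r addrC lerD.
  move=> z; rewrite inE => /orP[/eqP ->|zP] x Ax.
    by have [v vc xv] := c'y x Ax; exists v => //=; rewrite mem_cat [_ \in _]vc.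
  have [v vc xv] := cP z zP x Ax.
  by exists v => //=; rewrite mem_cat [X in _ || X]vc orbT.
exists c => // x Ax; have [y yP yx] := AP x Ax.
exact: (cP y yP).
Qed.

(** Choosing eps with l^(K eps) = 1/2 turns the gain 1/2 at a sparse scale
k <= K into l^(k eps).  A cover of B(e, r) at scale t is then obtained by
covering B(e, r) by the balls of the sparse scale and recursing into them; the
count (t/r)^(-u), u = Q - b - eps, is multiplicative, so the constant does not
grow.  The recursion stops when t / r is above the fixed ratio l^K. *)
Lemma assouad_dim_lt_of_growth b C : 0 < b -> 0 < C -> average_growth mu E b C ->
  (assouad_dim E < (Q - b)%:E)%E.
Proof.
move=> b0 C0 growth.
have [l [K [l01 K0 sparse]]] := exists_sparse_scale b C b0 C0 growth.
have /andP[l0 l1] := l01.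
have lK01 : 0 < l ^+ K < 1 by rewrite exprn_gt0//= exprn_ilt1 ?ltW// -lt0n.
have [eps eps0 lKeps] := exists_powR_ge_half _ lK01.
pose u := Q - b - eps.
have lk_eps k : (0 < k <= K)%N ->
    2^-1 * (l ^+ k) `^ (- (Q - b)) <= (l ^+ k) `^ (- u).
  move=> /andP[k0 kK]; have lk0 : 0 < l ^+ k by rewrite exprn_gt0.
  have -> : - u = eps + - (Q - b) by rewrite /u; ring.
  rewrite powRDg// ler_pM2r ?powR_gt0//; apply: le_trans lKeps _.
  apply: ge0_ler_powR; rewrite ?nnegrE ?exprn_ge0 ?(ltW l0) ?(ltW eps0)//.
  by apply: ler_wiXn2l => //; exact: ltW.
(* a sparse cover has at least one ball, so (l ^+ k) `^ (- u) >= 1 *)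
have u0 : 0 <= u.
  have [e Ee] := E_neq0.
  have one0 : 0 < 1 :> R by [].
  have [r /andP[r0 _] [rD _]] := ball_radius_lt_diam e 1 two_points one0.
  have [k [P [kK PE covP sP]]] := sparse e r Ee r0 rD.
  have lk01 : 0 < l ^+ k < 1.
    by rewrite exprn_gt0//= exprn_ilt1 ?ltW// -lt0n; case/andP: kK.
  have [y yP _] : (\bigcup_(y in [set` P]) ball y (l ^+ k * r)) e.
    by apply: covP; split=> //; apply/ballP; rewrite mdistxx.
  have P1 : 1 <= (size P)%:R :> R.
    by rewrite -[1]/(1%:R) ler_nat; case: (P) yP.
  rewrite leNgt; apply/negP => u0.
  have := le_trans P1 (le_trans sP (lk_eps k kK)); apply/negP; rewrite -ltNge.
  rewrite -[ltRHS](congr1 (fun f => f (- u)) (powR1 R)).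
  have /andP[lk0 lk1] := lk01.
  by apply: gt0_ltr_powR; rewrite ?oppr_gt0 ?nnegrE ?ler01 ?(ltW lk0).
have [s [s0 sE _]] := exists_assouad_exponent _ _ dimE_ltQ.
have [C1 C10 cover] := assouad_cover s s0 sE.
pose C2 := C1 * (l ^+ K) `^ (- s).
have claim n e r t : E e -> 0 < r -> (r%:E < 2%:E * diam [set: X])%E ->
    0 < t -> t <= r -> l ^+ n * r <= t ->
    exists2 c : seq X, (size c)%:R <= C2 * (t / r) `^ (- u) &
      E `&` ball e r `<=` \bigcup_(y in [set` c]) ball y t.
  elim/ltn_ind: n e r => n IH e r Ee r0 rD t0 tr nt.
  have [Kt|tK] := leP (l ^+ K * r) t.
    have [c csize ccov] := cover e t r t0 tr; exists c => //.
    apply: le_trans csize _; rewrite /C2 -mulrA ler_pM2l//.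
    apply: (@le_trans _ _ ((l ^+ K) `^ (- s) * 1)).
      rewrite mulr1; apply: ler_powR_neg; rewrite ?oppr_le0 ?ler_pdivlMr//.
      by case/andP: lK01.
    rewrite ler_pM2l ?powR_gt0 ?exprn_gt0//.
    apply: le_trans (_ : 1 `^ (- u) <= _); first by rewrite powR1.
    apply: ler_powR_neg; rewrite ?oppr_le0 ?divr_gt0//.
    by rewrite ler_pdivrMr// mul1r.
  have Kn : (K < n)%N.
    rewrite ltnNge; apply/negP => nK.
    have : l ^+ K <= l ^+ n by apply: ler_wiXn2l => //; exact: ltW.
    by rewrite -(ler_pM2r r0) leNgt (le_lt_trans nt tK).
  have [k [P [kK PE covP sP]]] := sparse e r Ee r0 rD.
  have /andP[k0 kK'] := kK.
  have lk0 : 0 < l ^+ k by rewrite exprn_gt0.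
  have lkr0 : 0 < l ^+ k * r by rewrite mulr_gt0.
  have lk1 : l ^+ k <= 1 by rewrite exprn_ile1// ltW.
  have [|c csize ccov] := cover_by_covers (E `&` ball e r) P (l ^+ k * r) t
      (C2 * (t / (l ^+ k * r)) `^ (- u)) _ covP.
    move=> y yP; have [| | | |c csize ccov] :=
      IH (n - k)%N _ y (l ^+ k * r) (PE y yP) lkr0 _ t0.
    - by rewrite ltn_subrL k0 (leq_trans _ Kn).
    - by apply: le_lt_trans rD; rewrite lee_fin ger_pMl.
    - apply/ltW/(lt_le_trans tK); rewrite ler_pM2r//.
      by apply: ler_wiXn2l => //; exact: ltW.
    - rewrite mulrA -exprD subnK//; exact: leq_trans kK' (ltnW Kn).
    - exists c => //; apply: subset_trans ccov => x [[Ex _] yx].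
      by split.
  exists c => //; apply: le_trans csize _.
  apply: le_trans (_ : (l ^+ k) `^ (- u) * (C2 * (t / (l ^+ k * r)) `^ (- u)) <= _).
    apply: ler_wpM2r; last exact: le_trans sP (lk_eps k kK).
    by rewrite !mulr_ge0 ?powR_ge0 ?ltW.
  rewrite mulrCA -powRMg ?divr_gt0//.
  have -> : l ^+ k * (t / (l ^+ k * r)) = t / r; last by [].
  by field; rewrite !gt_eqF.
have : (assouad_dim E <= u%:E)%E.
  apply: assouad_dim_le => //; exists (Num.max 1 C2); first by rewrite le_max lexx.
  move=> e t r Ee t0 tr rD; have r0 := lt_trans t0 tr.
  have [n ln] := exists_exprn_le _ _ l01 (divr_gt0 t0 r0).
  have [|c csize ccov] := claim n e r t Ee r0 rD t0 (ltW tr).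
    by rewrite -ler_pdivlMr.
  exists c; split=> //; apply: le_trans csize _.
  by rewrite ler_wpM2r ?powR_ge0// le_max lexx orbT.
move=> /le_lt_trans; apply; rewrite lte_fin /u; lra.
Qed.

(** * Necessity *)

Lemma lee_div_of_mul (a b : \bar R) (c A : R) : (0 <= a)%E -> 0 < c ->
  (c%:E <= b)%E -> (a * b <= A%:E)%E -> (a <= (A / c)%:E)%E.
Proof.
move=> a0 c0 cb abA; rewrite EFinM lee_pdivlMr//.
exact: le_trans (lee_wpmul2l a0 cb) abA.
Qed.

Lemma growth_of_muckenhoupt_pos p alpha : 1 < p -> 0 < alpha ->
  muckenhoupt mu p (dist_weight E alpha) ->
  exists2 C, 0 < C & average_growth mu E alpha C.
Proof.
move=> p1 alpha0 [_ [A A0]]; rewrite dist_weight_dual// => hA.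
have p10 : 0 < p - 1 by rewrite subr_gt0.
have g0 : 0 <= alpha / (p - 1) by rewrite divr_ge0// ltW.
have [k k0 low] := average_epow_ge _ g0.
exists (A / k `^ (p - 1)); first by rewrite divr_gt0 ?powR_gt0.
move=> e r _ r0 rD; set a := average _ _ _.
have a0 : (0 <= a)%E by apply: average_ge0 => // y; exact: epow_ge0.
have pw0 : 0 < k * r `^ (alpha / (p - 1)) by rewrite mulr_gt0 ?powR_gt0.
have kr0 : (0 <= (k * r `^ (alpha / (p - 1)))%:E)%E by rewrite lee_fin ltW.
have := lee_div_of_mul _ _ _ _ a0 (powR_gt0 (p - 1) pw0)
  (le_poweR _ _ _ (ltW p10) kr0 (low e r r0 rD)) (hA e r r0).
move=> /le_trans; apply; rewrite lee_fin powRMg ?powR_gt0//.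
rewrite -powRrM divfK ?gt_eqF// powRN.
rewrite le_eqVlt; apply/orP; left; apply/eqP; field.
by rewrite !gt_eqF ?powR_gt0.
Qed.

(** Here the weight is a positive power of delta, and it is the dual factor that
carries the negative power. *)
Lemma growth_of_muckenhoupt_neg p alpha : 1 < p -> alpha < 0 ->
  muckenhoupt mu p (dist_weight E alpha) ->
  exists2 C, 0 < C & average_growth mu E (- (alpha / (p - 1))) C.
Proof.
move=> p1 alpha0 [_ [A A0]]; rewrite dist_weight_dual// => hA.
have p10 : 0 < p - 1 by rewrite subr_gt0.
have g0 : 0 <= - alpha by rewrite oppr_ge0 ltW.
have [k k0 low] := average_epow_ge _ g0.
exists ((A / k) `^ (p - 1)^-1); first by rewrite powR_gt0 ?divr_gt0.
move=> e r _ r0 rD; rewrite opprK; set a := average _ _ _.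
have a0 : (0 <= a)%E by apply: average_ge0 => // y; exact: epow_ge0.
have pw0 : 0 < k * r `^ (- alpha) by rewrite mulr_gt0 ?powR_gt0.
have ap0 : (0 <= a `^ (p - 1))%E by exact: poweR_ge0.
have := lee_div_of_mul _ _ _ A ap0 pw0 (low e r r0 rD).
rewrite muleC => /(_ (hA e r r0)).
have ip0 : 0 <= (p - 1)^-1 by rewrite invr_ge0 ltW.
move=> /(le_poweR _ _ _ ip0 ap0).
rewrite -poweRrM mulfV ?gt_eqF// poweRe1// => /le_trans; apply.
rewrite poweR_EFin lee_fin invfM mulrA powRN invrK.
by rewrite powRMg ?divr_gt0 ?powR_gt0// -powRrM.
Qed.

Lemma growth_of_muckenhoupt1 alpha : 0 < alpha ->
  muckenhoupt1 mu (dist_weight E alpha) ->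
  exists2 C, 0 < C & average_growth mu E alpha C.
Proof.
move=> alpha0 [_ [A A0 hA]].
have [c [k [/andP[c0 _] k0 por]]] := porosity.
exists (A / c `^ alpha); first by rewrite divr_gt0 ?powR_gt0.
move=> e r _ r0 rD; set a := average _ _ _.
have a0 : (0 <= a)%E by apply: average_ge0 => // y; exact: epow_ge0.
have cr0 : 0 < c * r by rewrite mulr_gt0.
have := lee_div_of_mul _ _ _ _ a0 (powR_gt0 alpha cr0) _ (hA e r r0).
have -> : A / (c * r) `^ alpha = A / c `^ alpha * r `^ (- alpha).
  by rewrite powRMg// powRN; field; rewrite !gt_eqF ?powR_gt0.
apply; apply: (le_ess_sup_on _ (ball e r `&` [set y | c * r <= dist_set E y])).
- apply: measurableI; first exact: measurable_ball_metric.
  exact: measurable_dist_ge.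
- exact: subIsetl.
- apply: lt_le_trans (por e r r0 rD).
  by rewrite lte_fin mulr_gt0 ?powR_gt0.
- move=> y [_ /= cy]; rewrite /dist_weight inve_epow ?dist_set_ge0// opprK.
  by apply: epow_ge => //; exact: ltW.
Qed.

(** If alpha < 0, then 1/w = delta^alpha is unbounded on a ball centred on E: it
is at least (q r)^alpha on the ball of radius q r, for q arbitrarily small. *)
Lemma muckenhoupt1_exponent_ge0 alpha :
  muckenhoupt1 mu (dist_weight E alpha) -> 0 <= alpha.
Proof.
move=> [_ [A A0 hA]]; rewrite leNgt; apply/negP => alpha0.
have g0 : 0 < - alpha by rewrite oppr_gt0.
have [k k0 low] := average_epow_ge _ (ltW g0).
have [e Ee] := E_neq0.
have one0 : 0 < 1 :> R by [].
have [r /andP[r0 _] [rD _]] := ball_radius_lt_diam e 1 two_points one0.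
have rD4 := lt_diam_widen r rD.
have [q /andP[q0 q1] qk] :=
  exists_powR_le _ _ g0 (divr_gt0 k0 (mulr_gt0 (ltr0Sn R 1) A0)).
have qr0 : 0 < q * r by rewrite mulr_gt0.
have ess : (((q * r) `^ alpha)%:E <=
    ess_sup_on mu (ball e r) (fun y => (dist_weight E alpha y)^-1))%E.
  apply: (le_ess_sup_on _ (ball e (q * r))).
  - exact: measurable_ball_metric.
  - by apply: ball_sub; rewrite mdistxx add0r ger_pMl// ltW.
  - by have /andP[] := mu_ball e _ qr0.
  move=> y /(dist_set_ball E E_neq0)[+ _].
  rewrite (dist_set_in E E_neq0 e Ee) add0r => /ltW yq.
  rewrite /dist_weight inve_epow ?dist_set_ge0// opprK.
  by apply: epow_ge_neg => //; exact: dist_set_ge0.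
have avg := low e r r0 rD4.
have := lee_pmul _ _ avg ess; rewrite !lee_fin.
rewrite !mulr_ge0 ?powR_ge0 ?(ltW k0)// => /(_ isT isT)/le_trans/(_ (hA e r r0)).
rewrite -EFinM lee_fin powRMg// powRN.
have -> : k * (r `^ alpha)^-1 * (q `^ alpha * r `^ alpha) = k * q `^ alpha.
  by field; rewrite gt_eqF ?powR_gt0.
move: qk; rewrite powRN ler_pdivlMr ?mulr_gt0// ler_pdivrMl ?powR_gt0//.
by rewrite mulrC; lra.
Qed.

Lemma assouad_dim_fin_num : exists2 D, 0 <= D < Q & assouad_dim E = D%:E.
Proof.
have := assouad_dim_ge0 E; have := dimE_ltQ.
case: (assouad_dim E) => [D| |]// DQ D0; exists D => //.
by rewrite -!lee_fin -lte_fin D0.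
Qed.

End regular_space.

Theorem theorem1p1 (d : measure_display) (R : realType)
  (X : borelMetricType d R) (mu : {measure set X -> \bar R})
  (two_points : exists x y : X, x <> y)
  (mu_ball : forall (x : X) (r : R), 0 < r -> (0 < mu (ball x r) < +oo)%E)
  (mu_doubling : doubling mu)
  (Q : R) (Q_gt0 : 0 < Q) (mu_regular : ahlfors_regular mu Q)
  (E : set X) (E_neq0 : E !=set0) (E_closed : closed E)
  (dimE_ltQ : (assouad_dim E < Q%:E)%E)
  (alpha : R) :
  (forall p : R, 1 < p ->
     muckenhoupt mu p (dist_weight E alpha) <->
     ((1 - p)%:E * (Q%:E - assouad_dim E) < alpha%:E
        < Q%:E - assouad_dim E)%E) /\
  (muckenhoupt1 mu (dist_weight E alpha) <->
   (0%:E <= alpha%:E < Q%:E - assouad_dim E)%E).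
Proof.
have [D /andP[D0 DQ] dimE] := assouad_dim_fin_num E dimE_ltQ.
have dim_lt b C : 0 < b -> 0 < C -> average_growth mu E b C -> D < Q - b.
  move=> b0 C0 growth; rewrite -lte_fin -dimE.
  exact: (assouad_dim_lt_of_growth two_points mu_doubling Q_gt0 mu_regular
    E E_neq0 dimE_ltQ mu_ball b C b0 C0 growth).
rewrite dimE -EFinB; split=> [p p1|].
  have p10 : 0 < p - 1 by rewrite subr_gt0.
  have dual : (D < Q + alpha / (p - 1)) = ((1 - p) * (Q - D) < alpha).
    rewrite -(ltrBlDl D) (ltr_pdivlMr _ _ p10).
    by have -> : (D - Q) * (p - 1) = (1 - p) * (Q - D) by ring.
  rewrite -EFinM !lte_fin; split=> [Ap|/andP[low up]].
    have [alpha0|alpha0|->] := ltgtP alpha 0.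
    - have [C C0 growth] := growth_of_muckenhoupt_neg two_points mu_doubling
        Q_gt0 mu_regular E E_neq0 dimE_ltQ mu_ball p alpha p1 alpha0 Ap.
      have b0 : 0 < - (alpha / (p - 1)).
        by rewrite oppr_gt0 pmulr_llt0 ?invr_gt0.
      have := dim_lt _ _ b0 C0 growth; rewrite opprK dual => ->.
      by rewrite (lt_trans alpha0) ?subr_gt0.
    - have [C C0 growth] := growth_of_muckenhoupt_pos two_points mu_doubling
        Q_gt0 mu_regular E E_neq0 dimE_ltQ mu_ball p alpha p1 alpha0 Ap.
      have := dim_lt _ _ alpha0 C0 growth.
      by rewrite -dual ltrBrDl -ltrBrDr => ->; rewrite andbT ltr_wpDr// divr_ge0 ?ltW.
    - by rewrite subr_gt0 DQ andbT nmulr_rlt0 ?subr_gt0 ?subr_lt0.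
  apply: (muckenhoupt_dist_weight two_points mu_doubling Q_gt0 mu_regular E
    E_neq0 dimE_ltQ E_closed mu_ball) => //; rewrite dimE lte_fin ?dual//.
  by rewrite ltrBrDl -ltrBrDr.
rewrite lte_fin lee_fin; split=> [A1|/andP[alpha0 up]].
  have alpha0 := muckenhoupt1_exponent_ge0 two_points mu_doubling
    Q_gt0 mu_regular E E_neq0 dimE_ltQ mu_ball alpha A1.
  rewrite alpha0 /=; move: alpha0; rewrite le_eqVlt => /orP[/eqP <-|alpha0].
    by rewrite subr_gt0.
  have [C C0 growth] := growth_of_muckenhoupt1 two_points mu_doubling
    Q_gt0 mu_regular E E_neq0 dimE_ltQ mu_ball alpha alpha0 A1.
  by have := dim_lt _ _ alpha0 C0 growth; lra.
apply: (muckenhoupt1_dist_weight two_points mu_doubling Q_gt0 mu_regular E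
  E_neq0 dimE_ltQ E_closed mu_ball) => //; rewrite dimE lte_fin; lra.
Qed.
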